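(* Let $n$ and $l$ be positive integers. The height of the set of all words over an $l$-letter ordered alphabet that are not $n$-divisible, with respect to the set of words of length less than $n$, does not exceed $\Phi(n,l)$, where $$\Phi(n,l)=E_1\, l\cdot n^{E_2+12\log_3 n},\qquad E_1=4^{21\log_3 4+17},\qquad E_2=30\log_3 4+10.$$
   Context: Words are finite words over an alphabet $a_1\prec a_2\prec\dots\prec a_l$. The order on letters induces the (partial) lexicographic order on words: two words, one of which is a prefix of the other, are called incomparable; otherwise the words are compared by the letters at the first position where they differ. The notation $u\succ v$ means that $u$ and $v$ are comparable and $u$ is lexicographically larger than $v$. A word $W$ is $n$-divisible if it can be written as $W=vu_1u_2\cdots u_n$ with words $v,u_1,\dots,u_n$ such that $u_1\succ u_2\succ\dots\succ u_n$. A set $M$ of words has height $h$ over a set of words $Y$ if $h$ is the least number such that every word of $M$ can be written in the form $u_1^{k_1}u_2^{k_2}\cdots u_r^{k_r}$ with $u_1,\dots,u_r\in Y$, nonnegative integers $k_i$, and $r\leqslant h$. *)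

(* Defs.v *)
From HB Require Import structures.
From mathcomp Require Import all_boot all_order all_algebra.
From mathcomp Require Import boolp classical_sets reals exp.

Set Implicit Arguments.
Unset Strict Implicit.
Unset Printing Implicit Defensive.

Import Order.TTheory GRing.Theory Num.Theory.

(* The letter a_(i+1) is the ordinal i, so that the order on letters is the
   order of the underlying natural numbers. *)
Definition word (l : nat) : Type := seq 'I_l.

(* [lex_gt u v] is u \succ v: the order is only partial, and two words one of
   which is a prefix of the other (in particular equal words) are not related. *)
Fixpoint lex_gt (l : nat) (u v : word l) : bool :=
  match u, v with
  | a :: u', b :: v' => (b < a)%N || (a == b) && lex_gt u' v'
  | _, _ => false
  end.

(* Since \succ is transitive, [sorted], which only compares consecutive
   factors, expresses the whole chain u_1 \succ ... \succ u_n. *)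
Definition divisible (l n : nat) (w : word l) : Prop :=
  exists (v : word l) (us : seq (word l)),
    [/\ w = v ++ flatten us, size us = n & sorted (@lex_gt l) us].

Definition wexp (l : nat) (u : word l) (k : nat) : word l :=
  flatten (nseq k u).

(* The pair (u, k) in [s] stands for the factor u^k. *)
Definition height_at_most (l : nat) (M Y : set (word l)) (h : nat) : Prop :=
  forall w, M w -> exists s : seq (word l * nat),
    [/\ (size s <= h)%N,
        forall uk, uk \in s -> Y uk.1 &
        w = flatten [seq wexp uk.1 uk.2 | uk <- s]].

Definition has_height (l : nat) (M Y : set (word l)) (h : nat) : Prop :=
  height_at_most M Y h /\ forall h', height_at_most M Y h' -> (h <= h')%N.

Definition non_divisible_words (l n : nat) : set (word l) :=
  [set w : word l | ~ divisible n w]%classic.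

Definition words_shorter_than (l n : nat) : set (word l) :=
  [set w : word l | (size w < n)%N]%classic.

Arguments non_divisible_words l n : clear implicits.
Arguments words_shorter_than l n : clear implicits.

Local Open Scope ring_scope.

Definition log3 (R : realType) (x : R) : R := ln x / ln 3.

Definition E1 (R : realType) : R := 4 `^ (21 * log3 4 + 17).

Definition E2 (R : realType) : R := 30 * log3 4 + 10.

Definition Phi (R : realType) (n l : nat) : R :=
  E1 R * l%:R * n%:R `^ (E2 R + 12 * log3 n%:R).

(* Main.v *)
Require Import Defs.
From HB Require Import structures.
From mathcomp Require Import all_boot all_order all_algebra.
From mathcomp Require Import boolp classical_sets reals exp.
From mathcomp Require Import zify lra.

Set Implicit Arguments.
Unset Strict Implicit.
Unset Printing Implicit Defensive.

Import Order.TTheory GRing.Theory Num.Theory.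

(** Put m = n - 1 and let K be the least power of 2 that is at least m.  Pad the
    word w with infinitely many copies of a letter larger than all the others,
    and let P_k(i) be its factor of length k starting at position i.

    If w is not n-divisible, no n positions at mutual distances at least K carry
    strictly decreasing factors P_K: cutting w at these positions would give a
    division.  Hence the positions split into m classes, according to the length
    of the longest such decreasing chain ending there ([rank_classes]), and P_K
    is weakly increasing along each class, between positions at distance at
    least K.

    Call i a k-record when P_k(i) exceeds P_k(j) for all earlier j in its class.
    From K letters after a k-record up to the next one (of any class), P_k(i)
    depends only on the class of i ([code_const]).  Since P_2k(i) is made of
    P_k(i) and P_k(i + k), the pair of classes of i and i + k determines P_2k(i)
    whenever i and i + k lie in the same such zone, so that each zone accounts
    for at most m ^ 2 records of length 2k; the other positions are at most
    k + K per k-record.  Thus doubling k multiplies the number of records by at most m ^ 2 + 2K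
    ([size_records_double]); there are at most m (l + 1) records of length 1,
    so log2 K doublings leave a quasi-polynomial number of K-records.

    Finally, in a zone between K-records at most m <= K factors of length K occur.
    As in the Morse-Hedlund theorem, for some k < K the factors of length k then
    determine their right extensions, which forces the zone to be periodic with
    period at most m, after at most m letters ([eventually_periodic]).  Such a zone
    is a product of 3 powers of words of length at most m, and the K letters in
    front of it count as K more factors.  The height is therefore at most K + 3
    times the number of K-records ([height_le_records]).  *)

(** * Counting records of factor codes *)

(** Counting by an injection that is only given as a relation. *)
Lemma leq_size_rel (A B : eqType) (P : A -> B -> Prop) (s : seq A) (t : seq B) :
    uniq s -> {in s, forall a, exists2 b, b \in t & P a b} ->
    {in s &, forall a a' b, P a b -> P a' b -> a = a'} ->
  size s <= size t.
Proof.
elim: s t => [//|a s IHs] t /= /andP[a_s s_uniq] sP Pinj.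
have sub : {subset s <= a :: s} by move=> x xs; rewrite in_cons xs orbT.
have [b bt Pab] := sP a (mem_head _ _).
suff : size s <= size (rem b t).
  by rewrite size_rem //; case: t bt {sP} => //.
apply: IHs => // [a' a's|x y xs ys].
  have [b' b't Pab'] := sP a' (sub _ a's).
  exists b' => //; apply: rem_mem => //; apply/eqP => eqb.
  move: a_s; rewrite (Pinj a a' (mem_head _ _) (sub _ a's) b) ?a's //.
  by rewrite -eqb.
by apply: Pinj; exact: sub.
Qed.

Section Codes.

Variables (f : nat -> nat) (b : nat).
Hypothesis f_lt : forall i, f i < b.

(** The factor of length k at position i, read as a number in base b: the
    numerical order of such codes is the lexicographic order of factors of
    length k. *)
Fixpoint code (k i : nat) : nat :=
  if k is k'.+1 then code k' i * b + f (i + k') else 0.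

Lemma code_div k i : code k.+1 i %/ b = code k i.
Proof. by rewrite /= divnMDl ?(leq_ltn_trans _ (f_lt 0)) // divn_small ?addn0. Qed.

Lemma code_mod k i : code k.+1 i %% b = f (i + k).
Proof. by rewrite /= modnMDl modn_small. Qed.

Lemma leq_code k k' i j : k <= k' -> code k' i <= code k' j -> code k i <= code k j.
Proof.
elim: k' => [|k' IH]; first by rewrite leqn0 => /eqP ->.
rewrite leq_eqVlt => /predU1P[-> //|kk' le_ij]; apply: IH => //.
by rewrite -(code_div k' i) -(code_div k' j) leq_div2r.
Qed.

Lemma code_inj k k' i j : k <= k' -> code k' i = code k' j -> code k i = code k j.
Proof.
move=> kk' eq_ij; apply/eqP.
by rewrite eqn_leq !(@leq_code k k') // eq_ij.
Qed.

Lemma eq_codeP k i j :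
  (code k i = code k j) <-> (forall t, t < k -> f (i + t) = f (j + t)).
Proof.
elim: k => [|k IH]; split=> // [eq_ij t|eq_ij].
  rewrite ltnS leq_eqVlt => /predU1P[->|].
    by rewrite -!code_mod eq_ij.
  by apply/IH: t; apply: code_inj eq_ij.
by rewrite /= eq_ij // (IH.2 _) // => t tk; apply/eq_ij/ltnW.
Qed.

Lemma code_ltP k i j : code k i < code k j ->
  exists t, [/\ t < k, forall s, s < t -> f (i + s) = f (j + s)
              & f (i + t) < f (j + t)].
Proof.
elim: k => [//|k IH] lt_ij.
have := @leq_code k k.+1 i j (leqnSn k) (ltnW lt_ij).
rewrite leq_eqVlt => /predU1P[eq_ij|/IH[t [tk]]]; last by exists t; split=> //; lia.
exists k; split=> //; first exact/eq_codeP.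
by move: lt_ij; rewrite /= eq_ij ltn_add2l.
Qed.

Section Records.

Variables (m K : nat) (c : nat -> 'I_m).
Hypothesis c_mono :
  forall i j, c i = c j -> i + K <= j -> code K i <= code K j.

Definition record k i :=
  all (fun j => (c j == c i) ==> (code k j < code k i)) (iota 0 i).

Definition records k T := [seq i <- iota 0 T | record k i].

Lemma mem_records k T i : (i \in records k T) = record k i && (i < T).
Proof. by rewrite mem_filter mem_iota. Qed.

Lemma recordP k i :
  reflect (forall j, j < i -> c j = c i -> code k j < code k i) (record k i).
Proof.
apply: (iffP allP) => [ri j ji cji|ri j].
  by have := ri j; rewrite mem_iota ji cji eqxx => /(_ isT).
by rewrite mem_iota => ji; apply/implyP => /eqP; apply: ri.
Qed.

Lemma record_inj k i j : record k i -> record k j ->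
  c i = c j -> code k i = code k j -> i = j.
Proof.
move=> /recordP ri /recordP rj cij vij.
by case: (ltngtP i j) => // [/rj/(_ cij)|/ri/(_ (esym cij))]; rewrite vij ltnn.
Qed.

Lemma record0 k : record k 0. Proof. exact/recordP. Qed.

(** Going back from i to earlier positions of its class whose codes are no
    smaller, as long as there are any, ends at a record. *)
Lemma record_geq k i :
  exists a, [/\ record k a, a <= i, c a = c i & code k i <= code k a].
Proof.
elim/ltn_ind: i => i IH; have [ri|] := boolP (record k i); first by exists i.
case/allPn => j; rewrite mem_iota negb_imply => ji /andP[/eqP cji].
rewrite -leqNgt => le_ij; have [a [ra aj caj le_ja]] := IH j ji.
by exists a; split; [|lia|rewrite caj|lia].
Qed.

(** The code at i is at most that of some record a <= i of the same class.  Since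
    a <= r, this record is at distance at least K before j, so that [c_mono]
    makes its code at most that of j.  By symmetry the codes are equal. *)
Lemma code_const k r i j : k <= K -> c i = c j -> r + K <= i -> r + K <= j ->
  (forall x, record k x -> x <= maxn i j -> x <= r) -> code k i = code k j.
Proof.
move=> kK.
suff le i' j' : c i' = c j' -> r + K <= i' -> r + K <= j' ->
    (forall x, record k x -> x <= maxn i' j' -> x <= r) -> code k i' <= code k j'.
  move=> cij ri rj rec; apply/eqP; rewrite eqn_leq !le // => x.
  by rewrite maxnC; exact: rec.
move=> {}cij ri rj rec; have [a [ra ai ca]] := record_geq k i'.
move=> /leq_trans; apply; apply: (leq_code kK); apply: c_mono; first by rewrite ca.
by have := rec a ra; rewrite leq_max ai => /(_ isT); lia.
Qed.

Lemma last_record k T :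
  exists r, [/\ record k r, r <= T & forall x, record k x -> x <= T -> x <= r].
Proof.
have ex : exists r, record k r && (r <= T) by exists 0; rewrite record0.
have ub r : record k r && (r <= T) -> r <= T by case/andP.
case: (ex_maxnP ex ub) => r /andP[rr rT] rmax.
by exists r; split=> // x rx xT; apply: rmax; rewrite rx.
Qed.

Lemma size_records1 T : size (records 1 T) <= m * b.
Proof.
have -> : m * b = size (enum {: 'I_m * 'I_b}).
  by rewrite -cardE card_prod !card_ord.
apply: (@leq_size_rel _ _ (fun i p => p = (c i, Ordinal (f_lt i)))).
- by rewrite filter_uniq // iota_uniq.
- by move=> i _; exists (c i, Ordinal (f_lt i)); rewrite ?mem_enum.
- move=> i j; rewrite !mem_records => /andP[ri _] /andP[rj _] p -> [cij fij].
  by apply: record_inj ri rj _ _; rewrite //= !addn0 fij.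
Qed.

Lemma code_addn k k' i : code (k + k') i = code k i * b ^ k' + code k' (i + k).
Proof.
elim: k' => [|k' IH]; first by rewrite addn0 muln1 addn0.
by rewrite addnS /= IH expnSr mulnDl mulnA !addnA.
Qed.

(** A record r of length k + k is determined by the last k-record a <= r + k,
    together with either the classes of r and r + k, when a + K <= r so that
    [code_const] applies at both positions, or the offset r + k - a, which is
    then less than k + K. *)
Lemma size_records_double k T : k <= K ->
  size (records (k + k) T) <= size (records k (T + k)) * (m * m + (k + K)).
Proof.
move=> kK; pose X := ('I_m * 'I_m + 'I_(k + K))%type.
have -> : m * m + (k + K) = size (enum {: X}).
  by rewrite -cardE card_sum card_prod !card_ord.
rewrite -(size_allpairs pair).
pose P r (p : nat * X) := match p.2 with
  | inl cc => [/\ c r = cc.1, c (r + k) = cc.2, p.1 + K <= r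
              & forall x, record k x -> x <= r + k -> x <= p.1]
  | inr t => r + k = p.1 + t
  end.
apply: (@leq_size_rel _ _ P).
- by rewrite filter_uniq // iota_uniq.
- move=> r; rewrite mem_records => /andP[rr rT].
  have [a [ra a_le a_max]] := last_record k (r + k).
  have a_in : a \in records k (T + k) by rewrite mem_records ra; lia.
  case: (leqP (a + K) r) => [aK|Ka].
    exists (a, inl (c r, c (r + k))); last by split.
    by apply: (allpairs_f pair) => //; rewrite mem_enum.
  have lt : r + k - a < k + K by lia.
  exists (a, inr (Ordinal lt)); last by rewrite /P /=; lia.
  by apply: (allpairs_f pair) => //; rewrite mem_enum.
- move=> r r'; rewrite !mem_records => /andP[rr _] /andP[rr' _] [a [[c1 c2]|t]].
    rewrite /P /= => -[cr crk aK amax] [cr' crk' aK' amax'].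
    apply: record_inj rr rr' _ _; first by rewrite cr.
    rewrite !code_addn (@code_const k a r r') ?cr ?cr' //; last first.
      by move=> x rx; rewrite leq_max => /orP[]?; [apply: amax|apply: amax'] => //; lia.
    rewrite (@code_const k a (r + k) (r' + k)) ?crk ?crk' //; try lia.
    by move=> x rx; rewrite leq_max => /orP[]?; [apply: amax|apply: amax'] => //; lia.
  by rewrite /P /=; lia.
Qed.

Lemma size_records_expn s T : 2 ^ s <= K ->
  size (records (2 ^ s) T) <= m * b * (m * m + K.*2) ^ s.
Proof.
elim: s T => [|s IH] T sK; first by rewrite muln1 size_records1.
have sK' : 2 ^ s <= K by move: sK; rewrite expnS; lia.
rewrite expnS mul2n -addnn expnSr mulnA.
apply: leq_trans (size_records_double T sK') _.
by apply: leq_mul (IH _ sK') _; lia.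
Qed.

End Records.

(** * Few factors force periodicity *)

Definition factor_codes k lo hi : seq nat := undup [seq code k i | i <- index_iota lo hi].

Lemma mem_factor_codes k lo hi i :
  lo <= i < hi -> code k i \in factor_codes k lo hi.
Proof. by move=> i_in; rewrite mem_undup map_f // mem_index_iota. Qed.

Lemma factor_codesP k lo hi x : x \in factor_codes k lo hi ->
  exists2 i, lo <= i < hi & x = code k i.
Proof. by rewrite mem_undup => /mapP[i]; rewrite mem_index_iota; exists i. Qed.

(** Truncating to length k maps the factors of length k + 1 onto those of
    length k, and stays surjective when one of two factors with the same
    truncation is removed. *)
Lemma ltn_factor_codes k lo hi i j : lo <= i < hi -> lo <= j < hi ->
  code k i = code k j -> code k.+1 i <> code k.+1 j ->
  size (factor_codes k lo hi) < size (factor_codes k.+1 lo hi).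
Proof.
move=> i_in j_in eq_ij /eqP neq_ij.
have j_mem := mem_factor_codes k.+1 j_in.
suff: size (factor_codes k lo hi)
      <= size (rem (code k.+1 j) (factor_codes k.+1 lo hi)).
  by rewrite size_rem //; case: factor_codes j_mem.
apply: (@leq_size_rel _ _ (fun x y => y %/ b = x)); first exact: undup_uniq.
- move=> _ /factor_codesP[t t_in ->].
  have [eq_tj|neq_tj] := eqVneq (code k.+1 t) (code k.+1 j).
    exists (code k.+1 i); first exact/rem_mem/mem_factor_codes.
    by rewrite code_div eq_ij -(code_div k j) -eq_tj code_div.
  by exists (code k.+1 t); [exact/rem_mem/mem_factor_codes | rewrite code_div].
- by move=> x x' _ _ y <-.
Qed.

(** Otherwise the number of factors of length k would increase strictly with k,
    from at least 1 for k = 0 to at least K + 1 > m for k = K. *)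
Lemma deterministic_length (m K : nat) (c : nat -> 'I_m) lo hi :
    m <= K -> lo < hi ->
    (forall i j, lo <= i < hi -> lo <= j < hi -> c i = c j -> code K i = code K j) ->
  exists2 k, k < K & forall i j, lo <= i < hi -> lo <= j < hi ->
    code k i = code k j -> code k.+1 i = code k.+1 j.
Proof.
move=> mK lohi c_const.
set Q := (X in exists2 k, _ & X k).
suff grow k : k <= K -> (exists2 k', k' < k & Q k') \/ k < size (factor_codes k lo hi).
  have [[k kK Qk]|ltK] := grow K (leqnn K); first by exists k.
  suff leK : size (factor_codes K lo hi) <= size (enum 'I_m).
    by rewrite -cardE card_ord in leK; lia.
  apply: (@leq_size_rel _ _
    (fun x y => exists2 i, lo <= i < hi & x = code K i /\ c i = y)).
  - exact: undup_uniq.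
  - move=> _ /factor_codesP[i i_in ->].
    by exists (c i); [rewrite mem_enum | exists i].
  - move=> _ _ _ _ y [i i_in [-> ci]] [j j_in [-> cj]].
    by apply: c_const; rewrite // ci cj.
elim: k => [_|k IH kK].
  right; rewrite -has_predT; apply/hasP; exists (code 0 lo) => //.
  by apply: mem_factor_codes; rewrite leqnn.
have [[k' k'k Qk']|ltk] := IH (ltnW kK); first by left; exists k' => //; exact: ltnW.
have [Qk|nQk] := pselect (Q k); first by left; exists k.
right; apply: leq_ltn_trans ltk _.
apply: contrapT => nlt; apply: nQk => i j i_in j_in eq_ij.
by apply: contrapT => neq; apply: nlt; exact: ltn_factor_codes neq.
Qed.

Lemma code_consK k i j : code k.+1 i = code k.+1 j ->
  f i = f j /\ code k i.+1 = code k j.+1.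
Proof.
move=> /eq_codeP eq_ij; split; first by have := eq_ij 0 isT; rewrite !addn0.
by apply/eq_codeP => t tk; rewrite !addSnnS; apply: eq_ij.
Qed.

(** Two of the first m + 1 positions share a class, hence the code of length k
    given by [deterministic_length]; from there on, the code at a position
    determines the letter there and the code at the next position. *)
Lemma eventually_periodic (m K : nat) (c : nat -> 'I_m) lo hi :
    m <= K -> lo + m < hi ->
    (forall i j, lo <= i < hi -> lo <= j < hi -> c i = c j -> code K i = code K j) ->
  exists i d, [/\ lo <= i, 0 < d, i + d <= lo + m
    & forall t, i + d + t < hi -> f (i + t) = f (i + d + t)].
Proof.
move=> mK lohi c_const.
have lohi' : lo < hi by lia.
have [k kK det] := deterministic_length mK lohi' c_const.
have /injectivePn[x [y neq_xy cxy]] : ~~ injectiveb (fun t : 'I_m.+1 => c (lo + t)).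
  by apply/injectiveP => /leq_card; rewrite !card_ord ltnn.
wlog lt_xy : x y neq_xy cxy / x < y.
  move=> Th; case: (ltngtP x y) => [||/val_inj eq_xy]; first exact: Th.
    by apply: Th; rewrite // eq_sym.
  by rewrite eq_xy eqxx in neq_xy.
have ym := ltn_ord y.
exists (lo + x), (y - x); split; try lia.
have -> : lo + x + (y - x) = lo + y by lia.
suff eq_t t : lo + y + t < hi -> code k (lo + x + t) = code k (lo + y + t).
  by move=> t lt_t; have /det/code_consK[] := eq_t t lt_t; lia.
elim: t => [|t IH] lt_t.
  rewrite !addn0; apply: (@code_inj k K); first exact: ltnW.
  by apply: c_const => //; lia.
rewrite !addnS; have lt_t' : lo + y + t < hi by lia.
by have /det/code_consK[] := IH lt_t'; lia.
Qed.

End Codes.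

(** * Classes of positions in a non-divisible word *)

Section Words.

Variable l : nat.
Implicit Types (u v w : word l) (us : seq (word l)).

(** Beyond the end of w, the default value l stands for an extra letter larger
    than all the others. *)
Definition letter w i := nth l (map val w) i.

Lemma letter_lt w i : letter w i < l.+1.
Proof.
rewrite ltnS /letter; have [iw|/(nth_default _)-> //] := ltnP i (size (map val w)).
by have /mapP[a _ ->] := mem_nth l iw; apply/ltnW/ltn_ord.
Qed.

Lemma letter_ltl w i : (letter w i < l) = (i < size w).
Proof.
have [iw|wi] := ltnP i (size w).
  have : letter w i \in map val w by rewrite mem_nth ?size_map.
  by case/mapP => a _ ->; rewrite ltn_ord.
by rewrite /letter nth_default ?size_map // ltnn.
Qed.

Lemma letter_drop k w i : letter (drop k w) i = letter w (k + i).
Proof. by rewrite /letter map_drop nth_drop. Qed.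

Lemma letter_take k w i : i < k -> letter (take k w) i = letter w i.
Proof. by move=> ik; rewrite /letter map_take nth_take. Qed.

Lemma eq_letters u v : size u = size v ->
  (forall i, i < size u -> letter u i = letter v i) -> u = v.
Proof.
move=> suv eq_uv; apply: (inj_map val_inj).
by apply: (@eq_from_nth _ l); rewrite !size_map.
Qed.

Lemma lex_gt_letter t u v :
    (forall s, s < t -> letter u s = letter v s) ->
    letter v t < letter u t -> letter u t < l ->
  lex_gt u v.
Proof.
move=> eq_uv lt_vu ltl; have tu : t < size u by rewrite -letter_ltl.
have tv : t < size v by rewrite -letter_ltl (ltn_trans lt_vu).
elim: t u v eq_uv lt_vu tu tv {ltl} => [|t IH] [|a u] [|a' v] // eq_uv lt_vu tu tv.
  by apply/orP; left.
apply/orP; right; apply/andP; split; first exact/eqP/val_inj/(eq_uv 0).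
by apply: IH => // s st; apply: (eq_uv s.+1).
Qed.

Section Ranks.

Variables (w : word l) (K : nat).

Local Notation code := (code (letter w) l.+1).

(** There is a chain of q + 1 positions ending at i, with gaps at least K and
    strictly decreasing factors of length K. *)
Fixpoint descent_to q i :=
  if q is q'.+1
  then has (fun j => [&& j + K <= i, code K i < code K j & descent_to q' j]) (iota 0 i)
  else true.

Definition starts_as us i :=
  forall t, t < K -> i + t < size w -> letter (head [::] us) t = letter w (i + t).

(** The word is cut at the positions of the chain, starting from the last one.
    A cut piece has length at least K, and the next piece agrees with w up to
    the first difference of the two factors.  That difference lies inside w:
    the smaller letter there cannot be the padding letter. *)
Lemma descent_divisible q i us : descent_to q i ->
    flatten us = drop i w -> sorted (@lex_gt l) us -> us <> [::] ->
    starts_as us i ->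
  divisible (q + size us) w.
Proof.
elim: q i us => [|q IH] i us.
  move=> _ def_us us_sorted _ _; exists (take i w), us; split=> //.
  by rewrite def_us cat_take_drop.
case/hasP => j _ /and3P[jK /(code_ltP (letter_lt w))[t [tK eq_t lt_t]] desc_j].
move=> def_us us_sorted us_n0 us_i.
have it : i + t < size w by rewrite -letter_ltl; have := letter_lt w (j + t); lia.
have u_letter s : s < K -> letter (take (i - j) (drop j w)) s = letter w (j + s).
  by move=> sK; rewrite letter_take ?letter_drop //; lia.
rewrite addSnnS -[(size us).+1]/(size (take (i - j) (drop j w) :: us)).
apply: (IH j) => //=.
- rewrite def_us -{2}(cat_take_drop (i - j) (drop j w)) drop_drop.
  by congr (_ ++ drop _ _); lia.
- case: us us_n0 us_sorted us_i {def_us} => [//|u us] _ /= -> us_i.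
  rewrite andbT; apply: (@lex_gt_letter t).
  + move=> s st; rewrite u_letter; last by lia.
    by rewrite us_i -?eq_t //; lia.
  + by rewrite u_letter // us_i.
  + by rewrite u_letter // letter_ltl; lia.
- by move=> s sK _; exact: u_letter.
Qed.

Lemma no_descent m : ~ divisible m.+1 w -> forall i, ~~ descent_to m i.
Proof.
move=> nd i; apply/negP => desc_i; apply: nd.
rewrite -addn1; apply: (@descent_divisible m i [:: drop i w]) => //.
  by rewrite /= cats0.
by move=> t _ _; rewrite letter_drop.
Qed.

(** The class of i is the largest q such that a descending chain of q + 1
    positions ends at i.  If P_K(i) > P_K(j) with j at least K after i, such a
    chain to i extends to j, so that i and j have different classes. *)
Lemma rank_classes m : 0 < m -> ~ divisible m.+1 w ->
  exists c : nat -> 'I_m,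
    forall i j, c i = c j -> i + K <= j -> code K i <= code K j.
Proof.
move=> m_gt0 /no_descent nd.
pose rank i := find (fun q => ~~ descent_to q.+1 i) (iota 0 m).
have has_rank i : has (fun q => ~~ descent_to q.+1 i) (iota 0 m).
  apply/hasP; exists m.-1; first by rewrite mem_iota; lia.
  by rewrite prednK.
have rank_lt i : rank i < m by rewrite -[m in _ < m](size_iota 0) -has_find.
have rank_top i : ~~ descent_to (rank i).+1 i.
  by have := nth_find 0 (has_rank i); rewrite nth_iota; last exact: rank_lt.
have rank_desc i : descent_to (rank i) i.
  (* Minimality of the rank q + 1 says exactly that [descent_to q.+1 i]. *)
  case def_r: (rank i) => [//|q].
  have qr : q < rank i by rewrite def_r.
  have := before_find 0 qr; rewrite nth_iota; last exact: ltn_trans qr (rank_lt i).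
  by move/negbFE.
clearbody rank; exists (fun i => Ordinal (rank_lt i)) => i j /(congr1 val) /= eq_ij iK.
rewrite leqNgt; apply/negP => lt_ji; have /negP[] := rank_top j.
apply/hasP; have [ij|ji] := ltnP i j.
  exists i; rewrite ?mem_iota // iK lt_ji -eq_ij; exact: rank_desc.
have eqij : i = j by lia.
by rewrite eqij ltnn in lt_ji.
Qed.

End Ranks.

(** * Cutting a word at its records *)

Section Heights.

Variable n : nat.

Definition height_le w h := exists s : seq (word l * nat),
  [/\ size s <= h, forall uk, uk \in s -> words_shorter_than l n uk.1
    & w = flatten [seq wexp uk.1 uk.2 | uk <- s]].

Lemma height_le_cat u v h k :
  height_le u h -> height_le v k -> height_le (u ++ v) (h + k).
Proof.
move=> [s [sh sY ->]] [t [tk tY ->]]; exists (s ++ t); split.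
- by rewrite size_cat leq_add.
- by move=> uk; rewrite mem_cat => /orP[/sY|/tY].
- by rewrite map_cat flatten_cat.
Qed.

Lemma height_le_wexp u k : size u < n -> height_le (wexp u k) 1.
Proof.
move=> un; exists [:: (u, k)]; split=> //=; last by rewrite cats0.
by move=> uk; rewrite inE => /eqP ->.
Qed.

Lemma wexp1 u : wexp u 1 = u. Proof. exact: cats0. Qed.

Lemma height_le_short u : size u < n -> height_le u 1.
Proof. by move=> un; rewrite -[u]wexp1; exact: height_le_wexp. Qed.

Lemma height_le_letters u h : 1 < n -> size u <= h -> height_le u h.
Proof.
move=> n_gt1; elim: u h => [|a u IH] [|h] //=; try by exists [::].
rewrite ltnS => /IH; rewrite -cat1s -add1n; apply: height_le_cat.
exact: height_le_short.
Qed.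

(** A word of period d is a power of its prefix of length d followed by a word
    shorter than d. *)
Lemma height_le_periodic u d : 0 < d < n ->
    (forall t, d + t < size u -> letter u t = letter u (d + t)) ->
  height_le u 2.
Proof.
move=> /andP[d_gt0 dn] per.
have perq q t : q * d + t < size u -> letter u t = letter u (q * d + t).
  elim: q => [//|q IH] lt_t.
  rewrite IH; last by move: lt_t; rewrite mulSn; lia.
  by rewrite mulSn -addnA per // addnA -mulSn.
suff splitq q : q * d <= size u -> u = wexp (take d u) q ++ drop (q * d) u.
  rewrite (splitq _ (leq_trunc_div (size u) d)).
  apply: (@height_le_cat _ _ 1 1).
    apply: height_le_wexp; apply: leq_ltn_trans dn.
    by rewrite size_take_min geq_minl.
  apply: height_le_short; rewrite size_drop; apply: leq_ltn_trans dn.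
  by have := divn_eq (size u) d; have := ltn_pmod (size u) d_gt0; lia.
elim: q => [|q IH] qu; first by rewrite drop0.
rewrite {1}IH; last by move: qu; rewrite mulSn; lia.
rewrite /wexp -(addn1 q) nseqD flatten_cat /= cats0 -catA; congr cat.
rewrite -{1}(cat_take_drop d (drop _ u)) drop_drop mulnDl mul1n [d + _]addnC.
move: qu; rewrite mulSn => qu.
congr cat; apply: eq_letters.
  by rewrite !size_take_min size_drop; lia.
move=> i; rewrite size_take_min => id.
rewrite !letter_take ?letter_drop -?perq //; try lia.
Qed.

Lemma height_le_mono w h k : h <= k -> height_le w h -> height_le w k.
Proof. by move=> hk [s [sh sY ->]]; exists s; split=> //; exact: leq_trans hk. Qed.

End Heights.

Section RecordCuts.

Variables (w : word l) (m K : nat) (c : nat -> 'I_m).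
Hypotheses (m_gt0 : 0 < m) (mK : m <= K).

Local Notation code := (code (letter w) l.+1).
Local Notation records := (records (letter w) l.+1 c).
Local Notation record := (record (letter w) l.+1 c).

Hypothesis c_mono :
  forall i j, c i = c j -> i + K <= j -> code K i <= code K j.

(** The three factors are a preperiod, a power of the period, and a remainder. *)
Lemma height_le_constant lo hi : hi <= size w ->
    (forall i j, lo <= i < hi -> lo <= j < hi -> c i = c j -> code K i = code K j) ->
  height_le m.+1 (drop lo (take hi w)) 3.
Proof.
move=> hiw c_const; have size_hi : size (take hi w) = hi.
  by rewrite size_take_min; apply/minn_idPl.
have [short|long] := leqP hi (lo + m).
  apply: (@height_le_mono _ _ 1) => //; apply: height_le_short.
  by rewrite size_drop size_hi; lia.
have [i [d [lo_i d_gt0 idm per]]] := eventually_periodic (letter_lt w) mK long c_const.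
rewrite -(cat_take_drop (i - lo) (drop lo _)) drop_drop.
have -> : i - lo + lo = i by lia.
apply: (@height_le_cat _ _ _ 1 2).
  by apply: height_le_short; rewrite size_take_min size_drop size_hi; lia.
apply: (@height_le_periodic _ _ d); first by lia.
move=> t; rewrite size_drop size_hi => lt_t.
by rewrite !letter_drop !letter_take ?addnA ?per //; lia.
Qed.

Lemma size_records_split k r T : record k r -> r < T ->
  (size (records k r)).+1 <= size (records k T).
Proof.
move=> rr rT; rewrite -[_.+1]/(size (r :: records k r)).
apply: uniq_leq_size => [|x].
  by rewrite /= mem_records ltnn andbF filter_uniq ?iota_uniq.
rewrite inE => /predU1P[->|]; rewrite !mem_records ?rr //.
by case/andP => -> /ltn_trans; apply.
Qed.

(** The last record r < T cuts off the piece from r to T: its first K letters are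
    taken one by one, and the rest of it lies beyond r + K, where the class
    determines the factor of length K. *)
Lemma height_le_records : height_le m.+1 w ((K + 3) * size (records K (size w))).
Proof.
suff prefix T : T <= size w ->
    height_le m.+1 (take T w) ((K + 3) * size (records K T)).
  by have := prefix _ (leqnn _); rewrite take_size.
elim/ltn_ind: T => -[|T] IH Tw; first by rewrite take0; exists [::].
have [r [rr rT r_max]] := last_record (letter w) l.+1 c K T.
have := size_records_split rr (rT : r < T.+1); rewrite -(leq_pmul2l (_ : 0 < K + 3)) ?addn3 //.
move/height_le_mono; apply; rewrite -addn3 mulnS addnC.
rewrite -(cat_take_drop r (take T.+1 w)) take_takel; last exact: leqW.
apply: height_le_cat; first by apply: IH => //; lia.
rewrite -(cat_take_drop K (drop r _)) drop_drop.
apply: height_le_cat.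
  by apply: height_le_letters => //; rewrite size_take_min geq_minl.
apply: height_le_constant => // i j i_in j_in cij.
apply: (@code_const _ _ (letter_lt w) m K c c_mono K r) => //; try lia.
by move=> x rx; rewrite leq_max => /orP[]?; apply: r_max => //; lia.
Qed.

End RecordCuts.

End Words.

Lemma non_divisible_height l m (w : word l) (s := up_log 2 m) (K := 2 ^ s) :
    0 < m -> ~ divisible m.+1 w ->
  height_le m.+1 w ((K + 3) * (m * l.+1 * (m * m + K.*2) ^ s)).
Proof.
move=> m_gt0 w_nd; have mK : m <= K by exact: up_logP.
have [c c_mono] := rank_classes K m_gt0 w_nd.
apply: height_le_mono (height_le_records m_gt0 mK c_mono).
rewrite leq_mul2l; apply/orP; right.
exact: (size_records_expn (letter_lt w) c_mono).
Qed.

(** * Comparison with the closed form *)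

Lemma height_bound_leq m l (s := up_log 2 m) (K := 2 ^ s) (n := m.+1) :
    0 < m -> 0 < l ->
  (K + 3) * (m * l.+1 * (m * m + K.*2) ^ s) <= l * n ^ (9 + 4 * trunc_log 2 n).
Proof.
move=> m_gt0 l_gt0; set e := trunc_log 2 n.
have n_ge2 : 2 <= n by [].
have [K_le s_le] : K <= 2 * m /\ s <= e.+1.
  rewrite /K; have [m_gt1|m_le1] := ltnP 1 m; last first.
    have -> : s = 0 by rewrite /s (_ : m = 1) ?up_log1 //; lia.
    by lia.
  have := up_log_gtn (isT : 1 < 2) m_gt1; rewrite -/s => lt_m.
  have s_gt0 : 0 < s by rewrite up_log_gt0 m_gt1.
  split; first by rewrite -(prednK s_gt0) expnS; lia.
  rewrite -(prednK s_gt0) ltnS; apply: trunc_log_max => //; lia.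
have le_K3 : K + 3 <= n ^ 3.
  have : 4 * n <= n ^ 3 by rewrite !expnS expn0 muln1; nia.
  by rewrite /n; lia.
have le_base : m * m + K.*2 <= n ^ 4.
  have : (n * n) * 4 <= n ^ 4 by rewrite !expnS expn0 muln1; nia.
  by rewrite /n; nia.
have le_ml : m * l.+1 <= l * n ^ 2 by rewrite expnS expn1 /n; nia.
have -> : l * n ^ (9 + 4 * e) = n ^ 3 * (l * n ^ 2 * (n ^ 4) ^ e.+1).
  by rewrite mulnCA -mulnA -expnM -!expnD; congr (_ * _ ^ _); lia.
apply: leq_mul => //; apply: leq_mul => //.
apply: leq_trans (leq_pexp2l _ s_le); last by rewrite expn_gt0.
by case: (s) => // s'; rewrite leq_exp2r.
Qed.

(** The exponent 4 e, where 2 ^ e <= n, is at most 12 log_3 n because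
    3 ^ e <= 8 ^ e = (2 ^ e) ^ 3 <= n ^ 3. *)
Lemma Phi_lower_bound (R : realType) n l : 0 < n ->
  ((l * n ^ (9 + 4 * trunc_log 2 n))%:R <= Phi R n l)%R.
Proof.
move=> n_gt0; set e := trunc_log 2 n; rewrite /Phi.
have n_ge1 : (1 <= n%:R :> R)%R by rewrite ler1n.
have ln3_gt0 : (0 < ln 3 :> R)%R by rewrite ln_gt0 // ltr1n.
have log4_ge0 : (0 <= log3 4 :> R)%R.
  by rewrite divr_ge0 ?ln_ge0 ?ler1n.
have e_le : (e%:R <= 3 * log3 n%:R :> R)%R.
  rewrite /log3 mulrA ler_pdivlMr // mulr_natl -lnXn; last by rewrite ltr0n.
  rewrite mulr_natl -lnXn // ler_ln ?posrE ?exprn_gt0 ?ltr0n //.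
  rewrite -!natrX ler_nat; apply: (@leq_trans ((2 ^ e) ^ 3)).
    rewrite -expnM mulnC expnM; case: (e) => // e'; by rewrite leq_exp2r.
  by rewrite leq_exp2r // trunc_logP.
have E1_ge1 : (1 <= E1 R)%R.
  rewrite -(powRr0 4) ler_powR ?ler1n // addr_ge0 // mulr_ge0 //.
rewrite natrM natrX -powR_mulrn ?ler0n //.
apply: ler_pM; rewrite ?powR_ge0 ?ler0n //.
  by rewrite ler_peMl.
rewrite ler_powR // natrD natrM /E2; lra.
Qed.

Local Open Scope ring_scope.

Theorem mainTheorem1 (R : realType) (n l : nat) (hn : (0 < n)%N) (hl : (0 < l)%N) :
  exists h : nat,
    has_height (non_divisible_words l n) (words_shorter_than l n) h /\
    h%:R <= Phi R n l.
Proof.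
have bounded : height_at_most (non_divisible_words l n) (words_shorter_than l n)
    (l * n ^ (9 + 4 * trunc_log 2 n)).
  case: n hn => [//|[|m]] _ w w_nd.
    by case: w_nd; exists [::], [:: w]; rewrite /= cats0.
  apply: height_le_mono (height_bound_leq (isT : 0 < m.+1)%N hl) _.
  exact: non_divisible_height.
pose P h := `[< height_at_most (non_divisible_words l n) (words_shorter_than l n) h >].
have exP : exists h, P h by exists (l * n ^ (9 + 4 * trunc_log 2 n))%N; apply/asboolP.
(* The exact height is the least admissible bound. *)
case: (ex_minnP exP) => h /asboolP h_ok h_min; exists h; split.
  by split=> // h' h'_ok; apply/h_min/asboolP.
apply: le_trans (Phi_lower_bound R l hn); rewrite ler_nat.
exact/h_min/asboolP.
Qed.
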